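(* Let $m\ge 2$, $n\ge 1$, $0\le p\le m-1$. Order the vertices of ${\cal D}^*_m$ as $v_1,v_2,\dots$ with $v_1=0^m$, let ${\cal T}^*_m=[a_{ij}]$ be its adjacency matrix and $a^{(n)}_{ij}$ the $(i,j)$-entry of $({\cal T}^*_m)^n$. Then $$f^{TnC}_m(n)=a^{(n)}_{11},$$ $$f^{TG}_{m,p}(n)=\mathrm{tr}\big(({\cal R}^*_m)^p({\cal T}^*_m)^n\big)=\mathrm{tr}\big(({\cal T}^*_m)^n({\cal R}^*_m)^p\big)=\sum_{v_i,v_j\in V({\cal D}^*_m),\ v_i=\rho^p(v_j)}a^{(n)}_{ij},$$ $$f^{KB}_{m,p}(n)=\mathrm{tr}\big(({\cal R}^*_m)^p{\cal H}^*_m({\cal T}^*_m)^n\big)=\mathrm{tr}\big(({\cal T}^*_m)^n({\cal R}^*_m)^p{\cal H}^*_m\big)=\sum_{v_i,v_j\in V({\cal D}^*_m),\ \overline{v_i}=\rho^p(v_j)}a^{(n)}_{ij},$$ where $f^{TnC}_m(n)$, $f^{TG}_{m,p}(n)$, $f^{KB}_{m,p}(n)$ are the numbers of 2-factors of $TnC_m(n)$, $TG^{(p)}_m(n)$, $KB^{(p)}_m(n)$.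
   Context: Alpha-letters (2-element subsets of the directions up, down, left, right): $a=\{\text{right},\text{down}\}$, $b=\{\text{up},\text{down}\}$, $c=\{\text{right},\text{up}\}$, $d=\{\text{left},\text{down}\}$, $e=\{\text{left},\text{right}\}$, $f=\{\text{left},\text{up}\}$. ${\cal D}_{ud}$: arc $(\alpha,\beta)$ iff ($\text{down}\in\alpha\iff\text{up}\in\beta$); ${\cal D}_{lr}$: arc $(\alpha,\beta)$ iff ($\text{right}\in\alpha\iff\text{left}\in\beta$). ${\cal D}_m$: vertices are the words $\alpha_1\cdots\alpha_m\in\{a,\dots,f\}^m$ with $(\alpha_i,\alpha_{i+1})$ an arc of ${\cal D}_{ud}$ for $1\le i\le m$ ($\alpha_{m+1}:=\alpha_1$); arc $v\to u$ iff $(v_i,u_i)$ is an arc of ${\cal D}_{lr}$ for all $i$. Outlet word $o(\alpha)\in\{0,1\}^m$: $o_j=1$ iff $\alpha_j\in\{a,c,e\}$; inlet word $i(\alpha)$: $i_j=1$ iff $\alpha_j\in\{d,e,f\}$. ${\cal D}^*_m$: vertex set $\{o(x):x\in V({\cal D}_m)\}$, number of arcs from $v$ to $w$ equal to $|\{y\in V({\cal D}_m): i(y)=v,\ o(y)=w\}|$. For a binary word $v=b_1\cdots b_m$: $\overline{v}=b_m\cdots b_1$, $\rho(v)=b_2\cdots b_mb_1$, $\rho^p$ its $p$-th iterate. ${\cal R}^*_m=[r_{ij}]$ with $r_{ij}=1$ iff $\rho(v_i)=v_j$ (else 0); ${\cal H}^*_m=[h_{ij}]$ with $h_{ij}=1$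 iff $v_i=\overline{v_j}$ (else 0). Graphs: row indices mod $m$ in $\{1,\dots,m\}$. Multigraphs (loops/parallel edges allowed; for $m,n\ge 3$ the usual simple grids) on $\{1,\dots,m\}\times\{1,\dots,n\}$ with directed edge-ends: vertical edges joining $(i,j)$ (end ''down'') to $(i+1,j)$ (end ''up'') for all $i,j$; horizontal edges joining $(i,j)$ (end ''right'') to $(i,j+1)$ (end ''left'') for $j\le n-1$. $TnC_m(n)=C_m\times P_n$ has only these; $TG^{(p)}_m(n)$ also has, for each $i$, an edge joining $(i+p,n)$ (right) to $(i,1)$ (left); $KB^{(p)}_m(n)$ also has, for each $i$, an edge joining $(m+p+1-i,n)$ (right) to $(i,1)$ (left). A 2-factor is a set of edges such that every vertex carries exactly two edge-ends of chosen edges (a loop contributes two). *)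

(* Defs.v *)
From HB Require Import structures.
From mathcomp Require Import all_boot all_order all_algebra.

Set Implicit Arguments.
Unset Strict Implicit.
Unset Printing Implicit Defensive.

Import GRing.Theory.
Local Open Scope ring_scope.

Inductive dir := Up | Down | Left | Right.

Definition dir_code (x : dir) : bool * bool :=
  match x with
  | Up => (true, true) | Down => (true, false)
  | Left => (false, true) | Right => (false, false)
  end.

Definition dir_decode (x : bool * bool) : dir :=
  match x with
  | (true, true) => Up | (true, false) => Down
  | (false, true) => Left | (false, false) => Right
  end.

Lemma dir_codeK : cancel dir_code dir_decode.
Proof. by case. Qed.

HB.instance Definition _ := Finite.copy dir (can_type dir_codeK).

Inductive letter := La | Lb | Lc | Ld | Le | Lf.

Definition letter_code (x : letter) : nat :=
  match x with La => 0 | Lb => 1 | Lc => 2 | Ld => 3 | Le => 4 | Lf => 5 end%N.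

Definition letter_decode (k : nat) : letter :=
  nth La [:: La; Lb; Lc; Ld; Le; Lf] k.

Lemma letter_codeK : cancel letter_code letter_decode.
Proof. by case. Qed.

HB.instance Definition _ := Countable.copy letter (can_type letter_codeK).

Lemma letter_enumP : Finite.axiom [:: La; Lb; Lc; Ld; Le; Lf].
Proof. by case. Qed.

HB.instance Definition _ := isFinite.Build letter letter_enumP.

Definition dirs (x : letter) : {set dir} :=
  match x with
  | La => [set Right; Down]
  | Lb => [set Up; Down]
  | Lc => [set Right; Up]
  | Ld => [set Left; Down]
  | Le => [set Left; Right]
  | Lf => [set Left; Up]
  end.

Definition D_ud : rel letter :=
  fun x y => (Down \in dirs x) == (Up \in dirs y).

Definition D_lr : rel letter :=
  fun x y => (Right \in dirs x) == (Left \in dirs y).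

(* Positions in words and rows of grids are 0-based throughout: i : 'I_m stands
   for the index i + 1, and [ordS] is the successor modulo m. *)
Definition VD (m : nat) : {set m.-tuple letter} :=
  [set x | [forall i, D_ud (tnth x i) (tnth x (ordS i))]].

Definition arcD (m : nat) : rel (m.-tuple letter) :=
  fun x y => [forall i, D_lr (tnth x i) (tnth y i)].

Definition outlet (m : nat) (x : m.-tuple letter) : m.-tuple bool :=
  [tuple of [seq l \in [:: La; Lc; Le] | l <- x]].

Definition inlet (m : nat) (x : m.-tuple letter) : m.-tuple bool :=
  [tuple of [seq l \in [:: Ld; Le; Lf] | l <- x]].

Definition VDstar (m : nat) : {set m.-tuple bool} := [set outlet x | x in VD m].

Definition arcsDstar (m : nat) (v w : m.-tuple bool) : nat :=
  #|[set y in VD m | (inlet y == v) && (outlet y == w)]|.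

Definition zero_word (m : nat) : m.-tuple bool := [tuple of nseq m false].

Definition rev_word (m : nat) (v : m.-tuple bool) : m.-tuple bool :=
  [tuple of rev v].

Definition rho (m : nat) (v : m.-tuple bool) : m.-tuple bool :=
  [tuple of rot 1 v].

Definition vertex_ordering (m k : nat) (v : 'I_k -> m.-tuple bool) : Prop :=
  injective v /\ (forall w, w \in VDstar m <-> exists i, v i = w).

Lemma zero_word_VDstar (m : nat) : zero_word m \in VDstar m.
Proof.
apply/imsetP; exists [tuple of nseq m Lb].
  rewrite inE; apply/forallP=> i.
  by rewrite !(tnth_nth La) !nth_nseq !ltn_ord /D_ud !inE.
by apply: val_inj; rewrite /= map_nseq.
Qed.

Lemma vertex_ordering_ex (m : nat) :
  exists k, exists v : 'I_k.+1 -> m.-tuple bool,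
    vertex_ordering v /\ v ord0 = zero_word m.
Proof.
pose s := rem (zero_word m) (enum (VDstar m)).
have ps : perm_eq (enum (VDstar m)) (zero_word m :: s).
  by apply: perm_to_rem; rewrite mem_enum zero_word_VDstar.
exists (size s), (tnth (in_tuple (zero_word m :: s))); split; last first.
  by rewrite (tnth_nth (zero_word m)).
split.
  by apply/tuple_uniqP; rewrite -(perm_uniq ps) enum_uniq.
move=> w; rewrite -(mem_enum (VDstar m)) (perm_mem ps); split.
  by case/(tnthP (in_tuple (zero_word m :: s)))=> i ->; exists i.
by case=> i <-; apply: (mem_tnth i (in_tuple (zero_word m :: s))).
Qed.

Definition Tstar (m k : nat) (v : 'I_k -> m.-tuple bool) : 'M[nat]_k :=
  \matrix_(i, j) arcsDstar (v i) (v j).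

Definition Rstar (m k : nat) (v : 'I_k -> m.-tuple bool) : 'M[nat]_k :=
  \matrix_(i, j) (if rho (v i) == v j then 1%N else 0%N).

Definition Hstar (m k : nat) (v : 'I_k -> m.-tuple bool) : 'M[nat]_k :=
  \matrix_(i, j) (if v i == rev_word (v j) then 1%N else 0%N).

(* Each edge e has the two ends (e, false) and (e, true); each end is attached
   to a vertex, in a direction. *)
Record multigraph := Multigraph {
  vertex : finType;
  edge : finType;
  edge_end : edge -> bool -> vertex * dir
}.

Definition is_2factor (G : multigraph) (F : {set edge G}) : bool :=
  [forall x : vertex G,
    #|[set h : edge G * bool |
        (h.1 \in F) && ((edge_end h.1 h.2).1 == x)]| == 2%N].

Definition num_2factors (G : multigraph) : nat :=
  #|[set F : {set edge G} | is_2factor F]|.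

Section Grids.

Variables m n : nat.

(* For n >= 1 the type 'I_n.-1.+1 is the n columns, with first column [ord0]
   and last column [ord_max]; the grids are only meaningful for n >= 1. *)
Definition gvertex : finType := ('I_m * 'I_n.-1.+1)%type.

Definition vend (e : 'I_m * 'I_n.-1.+1) (s : bool) : gvertex * dir :=
  let: (i, j) := e in
  if s then ((ordS i, j), Up) else ((i, j), Down).

(* For j : 'I_n.-1, [lift ord_max j] has value j and [lift ord0 j] has
   value j + 1. *)
Definition hend (e : 'I_m * 'I_n.-1) (s : bool) : gvertex * dir :=
  let: (i, j) := e in
  if s then ((i, lift ord0 j), Left) else ((i, lift ord_max j), Right).

Definition TnC : multigraph :=
  @Multigraph gvertex ('I_m * 'I_n.-1.+1 + 'I_m * 'I_n.-1)%type
    (fun e => match e with inl e => vend e | inr e => hend e end).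

(* C_m x P_n plus, for each row i, an edge from (g i, n) to (i, 1). *)
Definition closed_grid (g : 'I_m -> 'I_m) : multigraph :=
  @Multigraph gvertex ('I_m * 'I_n.-1.+1 + 'I_m * 'I_n.-1 + 'I_m)%type
    (fun e => match e with
     | inl (inl e) => vend e
     | inl (inr e) => hend e
     | inr i => fun s =>
         if s then ((i, ord0), Left) else ((g i, ord_max), Right)
     end).

Definition add_row (p : nat) (i : 'I_m) : 'I_m :=
  Ordinal (ltn_pmod (i + p)%N (leq_ltn_trans (leq0n i) (ltn_ord i))).

Definition TG (p : nat) : multigraph := closed_grid (add_row p).

(* [rev_ord] is i |-> m + 1 - i on 1-based rows, so the row below is
   m + p + 1 - i modulo m. *)
Definition KB (p : nat) : multigraph :=
  closed_grid (fun i => add_row p (rev_ord i)).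

End Grids.

Definition f_TnC (m n : nat) : nat := num_2factors (TnC m n).
Definition f_TG (m p n : nat) : nat := num_2factors (TG m n p).
Definition f_KB (m p n : nat) : nat := num_2factors (KB m n p).

(* Main.v *)
Require Import Defs.
From HB Require Import structures.
From mathcomp Require Import all_boot all_order all_algebra.

Set Implicit Arguments.
Unset Strict Implicit.
Unset Printing Implicit Defensive.

Import GRing.Theory.
Local Open Scope ring_scope.

(** The chosen edge-ends at each vertex of a 2-factor form a two-element set of
    directions, i.e. a letter; so 2-factors are the letter fields that agree
    along every edge and use no direction without an edge.  Read column by
    column, the vertical edges say that each column lies in [VD m], and the
    horizontal ones that the outlet word of a column is the inlet word of the
    next.  Such fields are therefore the walks of length n in D*_m, counted by
    the powers of T*; the remaining edges (or their absence) only relate the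
    first inlet word to the last outlet word. *)

(** * 2-factors as compatible letter fields *)

(* Junk value unless #|S| = 2. *)
Definition letter_of (S : {set dir}) : letter :=
  if Right \in S then if Down \in S then La else if Up \in S then Lc else Le
  else if Left \in S then if Down \in S then Ld else Lf else Lb.

Lemma dirs_inj : injective dirs.
Proof.
move=> x y /setP e.
by move: (e Up) (e Down) (e Left) (e Right); case: x {e}; case: y; rewrite !inE.
Qed.

Lemma card_dirs (l : letter) : #|dirs l| = 2%N.
Proof. by case: l; rewrite cards2. Qed.

Lemma letter_ofK (S : {set dir}) : #|S| = 2%N -> dirs (letter_of S) = S.
Proof.
case/eqP/cards2P=> x [y [neq ->]].
by case: x neq; case: y => //= _; rewrite /letter_of !inE //= setUC.
Qed.

(** The second conjunct matters where a direction carries no edge-end, as Left in the first and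
    Right in the last column of [TnC]. *)
Definition compatible (G : multigraph) (L : {ffun vertex G -> letter}) : bool :=
  [forall e : edge G,
     let: (x, d) := edge_end e false in let: (y, d') := edge_end e true in
     (d \in dirs (L x)) == (d' \in dirs (L y))]
  && [forall x : vertex G, forall d : dir,
     (d \in dirs (L x)) ==> [exists h : edge G * bool, edge_end h.1 h.2 == (x, d)]].

(** Injectivity says that a vertex has at most one edge-end in each direction, so the chosen ends at
    a vertex are recorded faithfully by their directions, and two ends give a letter. *)
Lemma num_2factorsE (G : multigraph) :
  injective (fun h : edge G * bool => edge_end h.1 h.2) ->
  num_2factors G = #|[set L : {ffun vertex G -> letter} | compatible L]|.
Proof.
move=> end_inj.
pose chosen (L : {ffun vertex G -> letter}) (h : edge G * bool) :=
  (edge_end h.1 h.2).2 \in dirs (L (edge_end h.1 h.2).1).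
(* Testing the [false] end suffices: compatibility makes the [true] end agree. *)
pose phi (L : {ffun vertex G -> letter}) : {set edge G} :=
  [set e | chosen L (e, false)].
have compatP L : compatible L ->
  (forall e s, chosen L (e, s) = (e \in phi L)) /\
  (forall x d, d \in dirs (L x) -> exists h, edge_end h.1 h.2 = (x, d)).
  case/andP=> /forallP hc /forallP hf; split.
    move=> e [] ; rewrite inE // /chosen /=; move: (hc e).
    by case: (edge_end e false) (edge_end e true) => [x d] [y d'] /= /eqP.
  by move=> x d hd; move: (hf x) => /forallP/(_ d)/implyP/(_ hd)/existsP[h /eqP]; exists h.
(* The directions occupied by [F] at [x]; [letter_of] of this set inverts [phi]. *)
pose occ (F : {set edge G}) x : {set dir} :=
  [set (edge_end h.1 h.2).2 | h in [set h : edge G * bool |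
        (h.1 \in F) && ((edge_end h.1 h.2).1 == x)]].
have card_occ F x : #|occ F x| = #|[set h : edge G * bool |
        (h.1 \in F) && ((edge_end h.1 h.2).1 == x)]|.
  apply: card_in_imset => h h'; rewrite !inE => /andP[_ /eqP hx] /andP[_ /eqP hx'] hd.
  by apply: end_inj; rewrite [LHS]surjective_pairing hx -hx' hd -surjective_pairing.
have occP (F : {set edge G}) h : ((edge_end h.1 h.2).2 \in occ F (edge_end h.1 h.2).1) = (h.1 \in F).
  apply/imsetP/idP => [[h']|hF]; last by exists h; rewrite // inE hF eqxx.
  rewrite inE => /andP[hF /eqP hx] hd.
  suff -> : h = h' by [].
  by apply: end_inj; rewrite [LHS]surjective_pairing -hx hd -surjective_pairing.
have occ_phi L x : compatible L -> occ (phi L) x = dirs (L x).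
  move=> /compatP[hc hf]; apply/setP => d; apply/idP/idP.
    case/imsetP=> -[e s]; rewrite inE /= -(hc e s) /chosen /= => /andP[h /eqP hx] ->.
    by rewrite -hx.
  move=> hd; have [[e s] /= he] := hf x d hd.
  by have := occP (phi L) (e, s); rewrite /= he /= -(hc e s) /chosen /= he /= hd.
have phi_inj : {in [set L | compatible L] &, injective phi}.
  move=> L L'; rewrite !inE => hL hL' e; apply/ffunP => x.
  by apply: dirs_inj; rewrite -!occ_phi // e.
rewrite -(card_in_imset phi_inj); apply: eq_card => F; rewrite inE.
apply/idP/imsetP => [/forallP F2|[L]]; last first.
  rewrite inE => hL ->; apply/forallP => x.
  by rewrite -card_occ occ_phi // card_dirs.
pose L := [ffun x => letter_of (occ F x)].
have dL x : dirs (L x) = occ F x.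
  by rewrite ffunE letter_ofK // card_occ; apply/eqP.
exists L; last by apply/setP => e; rewrite inE /chosen dL occP.
rewrite inE; apply/andP; split.
  apply/forallP => e; have := occP F (e, false); have := occP F (e, true) => /=.
  by case: (edge_end e false) (edge_end e true) => [x d] [y d'] /=; rewrite !dL => -> ->.
apply/forallP => x; apply/forallP => d; apply/implyP; rewrite dL.
case/imsetP=> h; rewrite inE => /andP[_ /eqP hx] ->; apply/existsP; exists h.
by rewrite -hx -surjective_pairing.
Qed.

(** * Outlet and inlet words, rotation and reversal *)

Lemma tnth_outlet (m : nat) (x : m.-tuple letter) i :
  tnth (outlet x) i = (Right \in dirs (tnth x i)).
Proof. by rewrite tnth_map; case: (tnth x i); rewrite !inE. Qed.

Lemma tnth_inlet (m : nat) (x : m.-tuple letter) i :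
  tnth (inlet x) i = (Left \in dirs (tnth x i)).
Proof. by rewrite tnth_map; case: (tnth x i); rewrite !inE. Qed.

Lemma tnth_rho (m : nat) (w : m.-tuple bool) i : tnth (rho w) i = tnth w (ordS i).
Proof.
case: m w i => [|m] w i; first by case: i.
rewrite !(tnth_nth false) /= /rot nth_cat size_drop size_tuple subn1 /=.
case: ltnP => hi; first by rewrite nth_drop add1n modn_small.
have -> : (i : nat) = m by apply/eqP; rewrite eqn_leq hi -ltnS ltn_ord.
by rewrite subnn modnn; case: w => -[].
Qed.

Lemma tnth_iter_rho (m p : nat) (w : m.-tuple bool) i :
  tnth (iter p (@rho m) w) i = tnth w (add_row p i).
Proof.
elim: p i => [|p IH] i /=.
  by congr tnth; apply: val_inj; rewrite /= addn0 modn_small.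
rewrite tnth_rho IH; congr tnth; apply: val_inj.
by rewrite /= modnDml addSnnS.
Qed.

Lemma tnth_rev_word (m : nat) (w : m.-tuple bool) i :
  tnth (rev_word w) i = tnth w (rev_ord i).
Proof. by rewrite !(tnth_nth false) /= nth_rev size_tuple. Qed.

Lemma add_row_inj (m p : nat) : injective (@add_row m p).
Proof.
move=> i j /(congr1 val) /= /eqP; rewrite eqn_modDr !modn_small // => /eqP e.
exact: val_inj.
Qed.

(** The vertical condition on a column is cyclic, so the rotated column still satisfies it. This
    keeps [rho (v i)] among the indexed words when powers of [Rstar] are expanded. *)
Lemma VDstar_rho (m : nat) (w : m.-tuple bool) : w \in VDstar m -> rho w \in VDstar m.
Proof.
case/imsetP=> x; rewrite inE => /forallP hx ->.
apply/imsetP; exists [tuple tnth x (ordS i) | i < m].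
  by rewrite inE; apply/forallP => i; rewrite !tnth_mktuple.
by apply: eq_from_tnth => i; rewrite tnth_rho !tnth_outlet tnth_mktuple.
Qed.

Definition flip_lr (l : letter) : letter :=
  match l with La => Ld | Lb => Lb | Lc => Lf | Ld => La | Le => Le | Lf => Lc end.

(* Reflecting a column left-right exchanges its inlet and outlet words. *)
Lemma inlet_VDstar (m : nat) (x : m.-tuple letter) : x \in VD m -> inlet x \in VDstar m.
Proof.
rewrite inE => /forallP hx; apply/imsetP; exists [tuple of map flip_lr x].
  rewrite inE; apply/forallP => i; rewrite !tnth_map.
  by have := hx i; rewrite /D_ud; case: (tnth x i); case: (tnth x _); rewrite !inE.
apply: eq_from_tnth => i; rewrite tnth_outlet tnth_inlet tnth_map.
by case: (tnth x i); rewrite !inE.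
Qed.

(** * Walks as sequences of columns *)

(** A column [y] is an arc from [inlet y] to [outlet y], so [s] is the arc sequence of a walk from
    [u] to [w]. Recursion on the first arc matches the expansion of a matrix power. *)
Fixpoint walk (m : nat) (u : m.-tuple bool) (s : seq (m.-tuple letter))
    (w : m.-tuple bool) : bool :=
  if s is y :: s' then [&& y \in VD m, inlet y == u & walk (outlet y) s' w]
  else u == w.

Lemma walk_cons (m : nat) (u w : m.-tuple bool) y s :
  walk u (y :: s) w =
  [&& all (mem (VD m)) (y :: s), inlet y == u, outlet (last y s) == w
    & path (fun a b => outlet a == inlet b) y s].
Proof.
elim: s y u => [|z s IH] y u /=; first by rewrite !andbT.
have := IH z (outlet y); rewrite /= => ->.
by rewrite [outlet y == _]eq_sym; do !case: (_ \in _); rewrite ?andbF //=;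
  case: all; case: eqP; case: eqP; case: eqP; case: path.
Qed.

(** Bridge from the recursive form to conditions indexed by columns, which is how the grid edges are
    indexed. *)
Lemma walk_tupleP (m N : nat) (u w : m.-tuple bool) (t : N.+1.-tuple (m.-tuple letter)) :
  reflect [/\ forall j, tnth t j \in VD m, inlet (tnth t ord0) = u,
              outlet (tnth t ord_max) = w
            & forall j : 'I_N, outlet (tnth t (lift ord_max j)) = inlet (tnth t (lift ord0 j))]
          (walk u t w).
Proof.
case/tupleP: t => y s; rewrite walk_cons.
have -> : tnth [tuple of y :: s] ord0 = y by [].
have -> : tnth [tuple of y :: s] ord_max = last y s.
  by rewrite (tnth_nth y) /= (last_nth y) size_tuple.
have nthE (j : 'I_N) : (outlet (tnth [tuple of y :: s] (lift ord_max j)) =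
    outlet (nth y (y :: s) j)) * (tnth [tuple of y :: s] (lift ord0 j) = nth y s j).
  by rewrite !(tnth_nth y) /= /bump leqNgt ltn_ord add0n.
apply: (iffP and4P) => [[/all_tnthP h1 /eqP h2 /eqP h3 /(pathP y) h4]|[h1 h2 h3 h4]].
  split=> // j; rewrite !nthE; apply/eqP/h4; by rewrite size_tuple.
split; [exact/all_tnthP|exact/eqP|exact/eqP|].
apply/(pathP y) => j; rewrite size_tuple => hj.
by have := h4 (Ordinal hj); rewrite !nthE => ->.
Qed.

(** * Matrix entries as counts *)

Lemma bool_mulr (b c : bool) : (b && c : nat) = (b : nat) * (c : nat).
Proof. by case: b c => -[]. Qed.

(** A vertex ordering hits [w] exactly once, so the indicator leaves a single term. *)
Lemma sum_vertex (m k : nat) (v : 'I_k -> m.-tuple bool) (w : m.-tuple bool)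
    (F : m.-tuple bool -> nat) :
  vertex_ordering v -> w \in VDstar m -> \sum_l (w == v l : nat) * F (v l) = F w.
Proof.
case=> v_inj vP /vP[l0 <-]; rewrite (bigD1 l0) //= eqxx mul1r.
rewrite big1 ?addr0 // => l /negbTE hl.
by rewrite (inj_eq v_inj) eq_sym hl mul0r.
Qed.

Lemma sum_tupleS (T : finType) (n : nat) (F : seq T -> nat) :
  \sum_(t : n.+1.-tuple T) F t = \sum_y \sum_(t : n.-tuple T) F (y :: t).
Proof.
rewrite pair_big /= (reindex (fun p : T * n.-tuple T => [tuple of p.1 :: p.2])) //=.
apply: onW_bij; exists (fun t => (thead t, [tuple of behead t])).
  by case=> y t; rewrite /= theadE; congr pair; apply: val_inj.
by move=> t; rewrite /= [RHS]tuple_eta.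
Qed.

Lemma Tstar_exp (m n k : nat) (v : 'I_k.+1 -> m.-tuple bool) i j :
  vertex_ordering v ->
  (Tstar v ^+ n) i j = \sum_(t : n.-tuple (m.-tuple letter)) (walk (v i) t (v j) : nat).
Proof.
move=> hv; elim: n i => [|n IH] i.
  rewrite expr0 mxE (big_pred1 [tuple]) => [|t]; last by rewrite [t]tuple0; apply/esym/eqP.
  by rewrite /= (inj_eq hv.1); case: eqP.
rewrite exprS mxE (sum_tupleS n (fun t => walk (v i) t (v j) : nat)).
(* Writing the arc count as a sum over columns exposes the first column of the walk. *)
have TE l : Tstar v i l =
    \sum_y ((y \in VD m) && (inlet y == v i) : nat) * (outlet y == v l : nat).
  rewrite mxE /arcsDstar -sum1dep_card big_mkcond; apply: eq_bigr => y _.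
  by rewrite -bool_mulr -andbA; case: ifP.
under eq_bigr => l _ do rewrite TE IH mulr_suml.
rewrite exchange_big; apply: eq_bigr => y _ /=.
under eq_bigr => l _ do rewrite -mulrA.
rewrite -mulr_sumr.
have [yV|] := boolP (y \in VD m); last by rewrite mul0r big1.
(* The intermediate vertex is forced to be [outlet y]. *)
rewrite (sum_vertex (fun u => \sum_(t : n.-tuple _) (walk u t (v j) : nat))) ?imset_f //.
by rewrite mulr_sumr; apply: eq_bigr => t _; rewrite -bool_mulr.
Qed.

(** [Rstar] is the 0-1 matrix of the map [rho], and such matrices multiply as the maps compose. *)
Lemma Rstar_exp (m p k : nat) (v : 'I_k.+1 -> m.-tuple bool) i j :
  vertex_ordering v -> (Rstar v ^+ p) i j = (iter p (@rho m) (v i) == v j : nat).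
Proof.
move=> hv; elim: p i => [|p IH] i.
  by rewrite expr0 mxE /= (inj_eq hv.1); case: eqP.
rewrite exprS mxE iterSr.
rewrite -(@sum_vertex _ _ v (rho (v i)) (fun u => iter p (@rho m) u == v j : nat)) //.
  by apply: eq_bigr => l _; rewrite IH mxE; case: eqP.
by apply/VDstar_rho/hv.2; exists i.
Qed.

Lemma VDstar_iter_rho (m p : nat) (w : m.-tuple bool) :
  w \in VDstar m -> iter p (@rho m) w \in VDstar m.
Proof. by move=> hw; elim: p => //= p; apply: VDstar_rho. Qed.

Lemma RHstar_exp (m p k : nat) (v : 'I_k.+1 -> m.-tuple bool) i j :
  vertex_ordering v ->
  (Rstar v ^+ p *m Hstar v) i j = (iter p (@rho m) (v i) == rev_word (v j) : nat).
Proof.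
move=> hv; rewrite mxE.
rewrite -(@sum_vertex _ _ v (iter p (@rho m) (v i)) (fun u => u == rev_word (v j) : nat)) //.
  by apply: eq_bigr => l _; rewrite Rstar_exp // mxE; case: (v l == _).
by apply/VDstar_iter_rho/hv.2; exists i.
Qed.

(** * Letter fields and edge-ends of the grids *)

Definition field_of (m N : nat) (t : N.+1.-tuple (m.-tuple letter)) :
    {ffun 'I_m * 'I_N.+1 -> letter} :=
  [ffun x => tnth (tnth t x.2) x.1].

Lemma card_fields (m N : nat) (P : pred {ffun 'I_m * 'I_N.+1 -> letter}) :
  #|[set L | P L]| = \sum_(t : N.+1.-tuple (m.-tuple letter)) (P (field_of t) : nat).
Proof.
rewrite -sum1dep_card big_mkcond (reindex (@field_of m N)) /=.
  by apply: eq_bigr => t _; case: (P _).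
apply: onW_bij.
exists (fun L : {ffun 'I_m * 'I_N.+1 -> letter} =>
  [tuple [tuple L (i, j) | i < m] | j < N.+1]) => [t|L].
  by apply: eq_from_tnth => j; apply: eq_from_tnth => i; rewrite !tnth_mktuple ffunE.
by apply/ffunP => -[i j]; rewrite ffunE !tnth_mktuple.
Qed.

(** Ends of equal direction are separated by their vertices: [lift ord0 j] is never [ord0] and
    [lift ord_max j] never [ord_max], so inner and closing edges do not clash. Injectivity of [g]
    separates the Right ends of closing edges. *)
Lemma closed_grid_end_inj (m N : nat) (g : 'I_m -> 'I_m) : injective g ->
  injective (fun h : edge (closed_grid N.+1 g) * bool => edge_end h.1 h.2).
Proof.
move=> g_inj [[[[i j]|[i j]]|i] []] [[[[i' j']|[i' j']]|i'] []] //=.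
all: move=> h; have := congr1 (fun x => x.1.1) h;
  have := congr1 (fun x => x.1.2) h => /=.
- by move=> -> /(can_inj (@ordSK m)) ->.
- by move=> -> ->.
- by move=> /lift_inj -> ->.
- by move=> /lift_inj -> ->.
- by move/eqP; rewrite eq_sym (negbTE (neq_lift _ _)).
- by move=> _ ->.
- by move/eqP; rewrite (negbTE (neq_lift _ _)).
- by move=> _ /g_inj ->.
Qed.

Lemma TnC_end_inj (m N : nat) :
  injective (fun h : edge (TnC m N.+1) * bool => edge_end h.1 h.2).
Proof.
move=> [e s] [e' s'] h.
(* [inl] embeds the edges of [TnC] into a closed grid with the same ends; [id] is an arbitrary
   injective choice. *)
by case: (@closed_grid_end_inj m N id (fun _ _ => id) (inl e, s) (inl e', s') h) => -> ->.
Qed.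

(** Discharges the second conjunct of [compatible]. An injective [g] on the finite set of rows has
    an inverse, which finds the closing edge at a Right end in the last column. *)
Lemma closed_grid_end_surj (m N : nat) (g : 'I_m -> 'I_m) : injective g ->
  forall x d, exists h : edge (closed_grid N.+1 g) * bool, edge_end h.1 h.2 = (x, d).
Proof.
move=> g_inj [i j] []; last first.
- case: (unliftP ord_max j) => [j' ->|->].
    by exists (inl (inr (i, j')), false).
  by exists (inr (invF g_inj i), false); rewrite /= f_invF.
- case: (unliftP ord0 j) => [j' ->|->].
    by exists (inl (inr (i, j')), true).
  by exists (inr i, true).
- by exists (inl (inl (i, j)), false).
by exists (inl (inl (ord_pred i, j)), true); rewrite /= ord_predK.
Qed.

(** Vertical and inner horizontal edges make [t] a walk; the closing edge of row [r] compares the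
    first inlet at [r] with the last outlet at [g r]. *)
Lemma compatible_closed_grid (m N : nat) (g : 'I_m -> 'I_m)
    (t : N.+1.-tuple (m.-tuple letter)) : injective g ->
  @compatible (closed_grid N.+1 g) (field_of t)
  = walk (inlet (tnth t ord0)) t (outlet (tnth t ord_max))
    && [forall r, tnth (inlet (tnth t ord0)) r == tnth (outlet (tnth t ord_max)) (g r)].
Proof.
move=> g_inj; apply/idP/idP.
  case/andP=> /forallP /= hc _; apply/andP; split; last first.
    apply/forallP => r; have := hc (inr r); rewrite /= !ffunE /=.
    by rewrite tnth_inlet tnth_outlet eq_sym.
  apply/walk_tupleP; split=> // [j|j].
    rewrite inE; apply/forallP => i.
    by have := hc (inl (inl (i, j))); rewrite /= !ffunE.
  apply: eq_from_tnth => i; rewrite tnth_inlet tnth_outlet; apply/eqP.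
  by have := hc (inl (inr (i, j))); rewrite /= !ffunE.
case/andP=> /walk_tupleP[hV _ _ hh] /forallP hg; apply/andP; split; last first.
  apply/forallP => x; apply/forallP => d; apply/implyP => _; apply/existsP.
  by have [h hE] := closed_grid_end_surj g_inj x d; exists h; rewrite hE.
apply/forallP => -[[[i j]|[i j]]|i] /=; rewrite !ffunE /=.
- by have := hV j; rewrite inE => /forallP/(_ i).
- by rewrite -tnth_outlet -tnth_inlet hh.
- by rewrite -tnth_outlet -tnth_inlet eq_sym.
Qed.

Lemma compatible_TnC (m N : nat) (t : N.+1.-tuple (m.-tuple letter)) :
  @compatible (TnC m N.+1) (field_of t) = walk (zero_word m) t (zero_word m).
Proof.
have tnth0 i : tnth (zero_word m) i = false.
  by rewrite (tnth_nth true) nth_nseq ltn_ord.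
apply/idP/walk_tupleP.
  case/andP=> /forallP /= hc /forallP hf; split=> [j|||j].
  - rewrite inE; apply/forallP => i.
    by have := hc (inl (i, j)); rewrite /= !ffunE.
  - apply: eq_from_tnth => i; rewrite tnth_inlet tnth0; apply/negbTE/negP => hL.
    have /forallP/(_ Left) := hf (i, ord0); rewrite ffunE hL /=.
    (* Left ends only occur in columns [lift ord0 j'], never in the first one. *)
    by case/existsP=> -[[[i' j']|[i' j']] []] /= /eqP // /(congr1 (fun x => x.1.2)).
  - apply: eq_from_tnth => i; rewrite tnth_outlet tnth0; apply/negbTE/negP => hR.
    have /forallP/(_ Right) := hf (i, ord_max); rewrite ffunE hR /=.
    case/existsP=> -[[[i' j']|[i' j']] []] /= /eqP // /(congr1 (fun x => x.1.2))/eqP.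
    by rewrite eq_sym (negbTE (neq_lift _ _)).
  apply: eq_from_tnth => i; rewrite tnth_inlet tnth_outlet; apply/eqP.
  by have := hc (inr (i, j)); rewrite /= !ffunE.
case=> hV h0 h1 hh; apply/andP; split.
  apply/forallP => -[[i j]|[i j]] /=; rewrite !ffunE /=.
    by have := hV j; rewrite inE => /forallP/(_ i).
  by rewrite -tnth_outlet -tnth_inlet hh.
apply/forallP => -[i j]; apply/forallP => d; apply/implyP.
rewrite ffunE /= => hd; apply/existsP; case: d hd => hd.
- by exists (inl (ord_pred i, j), true); rewrite /= ord_predK.
- by exists (inl (i, j), false).
- case: (unliftP ord0 j) hd => [j' ->|->]; first by exists (inr (i, j'), true).
  by rewrite -tnth_inlet h0 tnth0.
case: (unliftP ord_max j) hd => [j' ->|->]; first by exists (inr (i, j'), false).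
by rewrite -tnth_outlet h1 tnth0.
Qed.

(** * From closed grids to traces *)

Lemma num_2factors_closed_grid (m N k : nat) (g : 'I_m -> 'I_m)
    (v : 'I_k.+1 -> m.-tuple bool) : injective g -> vertex_ordering v ->
  num_2factors (closed_grid N.+1 g)
  = \sum_i \sum_(j | [forall r, tnth (v i) r == tnth (v j) (g r)])
      (Tstar v ^+ N.+1) i j.
Proof.
move=> g_inj hv.
rewrite (num_2factorsE (@closed_grid_end_inj m N g g_inj)) card_fields.
pose P (u w : m.-tuple bool) := [forall r, tnth u r == tnth w (g r)].
transitivity (\sum_(t : N.+1.-tuple (m.-tuple letter)) \sum_i \sum_j
    (P (v i) (v j) : nat) * (walk (v i) t (v j) : nat)); last first.
  rewrite exchange_big; apply: eq_bigr => i _.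
  rewrite exchange_big [RHS]big_mkcond; apply: eq_bigr => j _ /=.
  by rewrite -mulr_sumr -Tstar_exp // -/(P _ _); case: (P _ _); rewrite ?mul1r ?mul0r.
apply: eq_bigr => t _; rewrite compatible_closed_grid //.
set u := inlet _; set w := outlet _; rewrite -/(P u w).
(* A nonempty column sequence determines its end words, so at most one pair of indices
   contributes. *)
have walkE u' w' : walk u' t w' = [&& u == u', w == w' & walk u t w].
  apply/idP/and3P => [h|[/eqP <- /eqP <-] //].
  have [_ hu hw _] := walk_tupleP _ _ _ h.
  by split; [apply/eqP|apply/eqP|move: h; rewrite -hu -hw].
have [h|h] := boolP (walk u t w); last first.
  by rewrite big1 // => i _; rewrite big1 // => j _; rewrite walkE (negbTE h) !andbF mulr0.
have [hV _ _ _] := walk_tupleP _ _ _ h.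
rewrite -(@sum_vertex _ _ v u (fun u => P u w : nat)) ?inlet_VDstar //.
apply: eq_bigr => i _.
rewrite -(@sum_vertex _ _ v w (fun w => P (v i) w : nat)) ?imset_f // mulr_sumr.
apply: eq_bigr => j _; rewrite walkE h andbT bool_mulr.
by rewrite mulrA mulrC.
Qed.

Theorem theorem5 (m n p : nat) (hm : (2 <= m)%N) (hn : (1 <= n)%N)
    (hp : (p <= m - 1)%N)
    (k : nat) (v : 'I_k.+1 -> m.-tuple bool)
    (hv : vertex_ordering v) (hv0 : v ord0 = zero_word m) :
  let T := Tstar v in
  let R := Rstar v in
  let H := Hstar v in
  [/\ f_TnC m n = (T ^+ n) ord0 ord0,
      [/\ f_TG m p n = \tr (R ^+ p *m T ^+ n),
          \tr (R ^+ p *m T ^+ n) = \tr (T ^+ n *m R ^+ p)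
        & \tr (T ^+ n *m R ^+ p)
          = \sum_i \sum_(j | v i == iter p (@rho m) (v j)) (T ^+ n) i j]
    & [/\ f_KB m p n = \tr (R ^+ p *m H *m T ^+ n),
          \tr (R ^+ p *m H *m T ^+ n) = \tr (T ^+ n *m R ^+ p *m H)
        & \tr (T ^+ n *m R ^+ p *m H)
          = \sum_i \sum_(j | rev_word (v i) == iter p (@rho m) (v j))
              (T ^+ n) i j]].
Proof.
(* With [n] equal to [N.+1] the column type ['I_n.-1.+1] reduces to ['I_N.+1]. *)
case: n hn => // N _ T R H.
have trTR : \tr (T ^+ N.+1 *m R ^+ p)
    = \sum_i \sum_(j | v i == iter p (@rho m) (v j)) (T ^+ N.+1) i j.
  apply: eq_bigr => i _; rewrite mxE [RHS]big_mkcond; apply: eq_bigr => j _.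
  by rewrite Rstar_exp // eq_sym; case: eqP; rewrite ?mulr1 ?mulr0.
have trTRH : \tr (T ^+ N.+1 *m R ^+ p *m H)
    = \sum_i \sum_(j | rev_word (v i) == iter p (@rho m) (v j)) (T ^+ N.+1) i j.
  rewrite -mulmxA; apply: eq_bigr => i _; rewrite mxE [RHS]big_mkcond.
  by apply: eq_bigr => j _; rewrite RHstar_exp // eq_sym; case: eqP; rewrite ?mulr1 ?mulr0.
split.
- rewrite /f_TnC (num_2factorsE (@TnC_end_inj m N)) card_fields Tstar_exp // hv0.
  by apply: eq_bigr => t _; rewrite compatible_TnC.
- split=> //; last exact: mxtrace_mulC.
  rewrite mxtrace_mulC trTR /f_TG (num_2factors_closed_grid N (@add_row_inj m p) hv).
  apply: eq_bigr => i _; apply: eq_bigl => j.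
  (* The closing condition compares row [r] of [v i] with row [r + p] of [v j]. *)
  apply/forallP/eqP => [h|-> r]; last by rewrite tnth_iter_rho.
  by apply: eq_from_tnth => r; rewrite tnth_iter_rho; apply/eqP.
- split=> //; last by rewrite mxtrace_mulC mulmxA.
  rewrite mxtrace_mulC mulmxA trTRH /f_KB.
  rewrite (num_2factors_closed_grid N (inj_comp (@add_row_inj m p) rev_ord_inj) hv).
  apply: eq_bigr => i _; apply: eq_bigl => j.
  (* Here [g] reverses before shifting; substituting [rev_ord r] for [r] moves the reversal onto
     [v i]. *)
  apply/forallP/eqP => [h|h r].
    apply: eq_from_tnth => r; rewrite tnth_iter_rho tnth_rev_word.
    by rewrite (eqP (h (rev_ord r))) /= rev_ordK.
  by rewrite /= -tnth_iter_rho -h tnth_rev_word rev_ordK.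
Qed.
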